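(* Let $\eta,\mu\ge 3$ and $m\ge 2$ be integers. Then the algebraic connectivity of $W'(\eta,\mu)\times K_m$ is $$(m-1)\left(\frac{\mu+\eta-\sqrt{(\mu+\eta)^2-4\eta}}{2}\right).$$
   Context: All graphs are finite and simple. The Laplacian matrix of a graph is its diagonal degree matrix minus its adjacency matrix; the algebraic connectivity of a graph is the second smallest eigenvalue (counted with multiplicity) of its Laplacian matrix. The Kronecker product $Y_1\times Y_2$ has vertex set $V(Y_1)\times V(Y_2)$, with $(y_1,y_2)$ and $(y_1',y_2')$ adjacent iff $y_1$ is adjacent to $y_1'$ in $Y_1$ and $y_2$ is adjacent to $y_2'$ in $Y_2$. $K_r$ is the complete graph on $r$ vertices. $W'(\eta,\mu)$ is the graph on $\eta\mu$ vertices obtained from the complete graph $K_\eta$ by attaching to each vertex $v$ of $K_\eta$ its own copy of $K_\mu$, that is, by identifying $v$ with one vertex of that copy (the copies being otherwise disjoint). *)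

(* Defs.v *)
From mathcomp Require Import all_boot all_order all_algebra.
From mathcomp Require Import polyrcf.

Set Implicit Arguments.
Unset Strict Implicit.
Unset Printing Implicit Defensive.

Import Order.TTheory GRing.Theory Num.Theory.
Local Open Scope ring_scope.

Record sgraph := SGraph {
  vertex :> finType;
  adj : rel vertex;
  adj_sym : symmetric adj;
  adj_irrefl : irreflexive adj }.

Section GraphConstructions.

Definition complete_adj n : rel 'I_n := fun x y => x != y.

Fact complete_sym n : symmetric (@complete_adj n).
Proof. by move=> x y; rewrite /complete_adj eq_sym. Qed.

Fact complete_irrefl n : irreflexive (@complete_adj n).
Proof. by move=> x; rewrite /complete_adj eqxx. Qed.

Definition complete n := SGraph (@complete_sym n) (@complete_irrefl n).

Definition kronecker_adj (G H : sgraph) : rel (G * H)%type :=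
  fun x y => adj x.1 y.1 && adj x.2 y.2.

Fact kronecker_sym G H : symmetric (@kronecker_adj G H).
Proof.
by move=> x y; rewrite /kronecker_adj adj_sym [adj x.2 _]adj_sym.
Qed.

Fact kronecker_irrefl G H : irreflexive (@kronecker_adj G H).
Proof. by move=> x; rewrite /kronecker_adj adj_irrefl. Qed.

Definition kronecker G H :=
  SGraph (@kronecker_sym G H) (@kronecker_irrefl G H).

(* The vertex (i, j) is the vertex j of the copy of K_mu attached to the      *)
(* vertex i of K_eta. The vertex of that copy that is identified with i is    *)
(* the one of value 0, so that the vertices (i, 0) span K_eta.                *)
Definition Wprime_adj eta mu : rel ('I_eta * 'I_mu)%type :=
  fun x y =>
    ((x.1 == y.1) && (adj (s := complete mu) x.2 y.2))
    || [&& adj (s := complete eta) x.1 y.1,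
           val x.2 == 0%N & val y.2 == 0%N].

Fact Wprime_sym eta mu : symmetric (@Wprime_adj eta mu).
Proof.
move=> x y; rewrite /Wprime_adj eq_sym (@adj_sym (complete mu)) (@adj_sym (complete eta)).
by congr (_ || (_ && _)); rewrite andbC.
Qed.

Fact Wprime_irrefl eta mu : irreflexive (@Wprime_adj eta mu).
Proof. by move=> x; rewrite /Wprime_adj (@adj_irrefl (complete mu)) andbF (@adj_irrefl (complete eta)). Qed.

Definition Wprime eta mu :=
  SGraph (@Wprime_sym eta mu) (@Wprime_irrefl eta mu).

End GraphConstructions.

Section Laplacian.

Variables (R : rcfType) (G : sgraph).

Definition degree (x : G) : nat := #|[pred y | adj x y]|.

(* Rows and columns are indexed by the enumeration of the vertices. *)
Definition adjacency_mx : 'M[R]_#|G| :=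
  \matrix_(i, j) (adj (enum_val i) (enum_val j))%:R.

Definition degree_mx : 'M[R]_#|G| :=
  diag_mx (\row_i (degree (enum_val i))%:R).

Definition laplacian_mx : 'M[R]_#|G| := degree_mx - adjacency_mx.

End Laplacian.

(* The eigenvalues of A in R, in nondecreasing order, each one repeated       *)
(* according to its multiplicity as a root of the characteristic polynomial.  *)
(* For a symmetric A these are all the eigenvalues of A, and this             *)
(* multiplicity is the dimension of the eigenspace.                           *)
Definition eigenvalues (R : rcfType) n (A : 'M[R]_n) : seq R :=
  sort <=%R
    (flatten [seq nseq (mup x (char_poly A)) x | x <- rootsR (char_poly A)]).

(* Item 1 is the second smallest one, as nth numbers items from 0; the        *)
(* default value 0 is only reached on graphs with fewer than two vertices.    *)
Definition algebraic_connectivity (R : rcfType) (G : sgraph) : R :=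
  nth 0 (eigenvalues (laplacian_mx R G)) 1.

Lemma eigenvaluesE (R : rcfType) n (A : 'M[R]_n) (s : seq R) :
  char_poly A = \prod_(x <- s) ('X - x%:P) -> eigenvalues A = sort <=%R s.
Proof.
move=> As; rewrite /eigenvalues; apply/perm_sort_leP.
have p0 : char_poly A != 0 by rewrite monic_neq0 // char_poly_monic.
have memR x : (x \in rootsR (char_poly A)) = (x \in s).
  have /(_ x) := roots_on_rootsR p0.
  by rewrite in_itv /= As root_prod_XsubC => ->.
apply/allP => x _ /=; rewrite count_flatten -map_comp sumnE big_map.
rewrite -(mu_prod_XsubC x s) -As.
have uR : uniq (rootsR (char_poly A)) by exact: uniq_roots.
under eq_bigr => y _ do rewrite /= count_nseq.
have [xR | xNR] := boolP (x \in rootsR (char_poly A)).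
  rewrite (bigD1_seq x) //= eqxx mul1n big1 ?addn0 // => y /negbTE yx.
  by rewrite /= yx mul0n.
rewrite big_seq big1 => [|y yR].
  rewrite mupNroot //; move: xNR; rewrite memR => xs.
  by rewrite As root_prod_XsubC.
rewrite /=; case: eqVneq => [yx|]; last by rewrite mul0n.
by rewrite yx (negbTE xNR) in yR.
Qed.

(* Main.v *)
(* The Laplacian L of W' x K_m splits along the eigenspaces of K_m into        *)
(* (m - 1) (D - A) and (m - 1) D + A, for D and A the degree and adjacency     *)
(* matrices of W'. On W', the leaves of each copy of K_mu take a common value  *)
(* in the eigenvectors at stake, and eliminating it leaves a scalar equation   *)
(* on K_eta. For D - A and vectors with sum 0 on K_eta, it is                  *)
(* y^2 - (mu + eta) y + eta = 0, whose smaller root alpha < 1 is the algebraic *)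
(* connectivity of W'; (m - 1) D + A has no eigenvalue below m - 1. So L has   *)
(* only constant eigenvectors below (m - 1) alpha. As the sums of the rows and *)
(* columns of L vanish, this also makes 0 a simple root of its characteristic  *)
(* polynomial, so the full spectrum of L is never needed.                      *)

Require Import Defs.
From mathcomp Require Import all_boot all_order all_algebra.
From mathcomp Require Import polyrcf ring lra.

Import Order.TTheory GRing.Theory Num.Theory.
Local Open Scope ring_scope.

(** By [algebraic_connectivityE] it suffices that (m - 1) alpha is an eigenvalue and that
    eigenfunctions for smaller values are constant. An eigenvector of W' for alpha
    ([Wprime_laplacian_eigenvector]) is carried to the product by [laplacian_op_lift]. For smaller
    values, [kronecker_complete_const] leaves two problems on W': constancy for D - A below alpha
    ([Wprime_laplacian_const]) and vanishing for (m - 1) D + A below m - 1 ([Wprime_signless_eq0]).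
    Both rest on the elimination of the leaves in [Wprime_reduce]. *)

(** * Zero as a simple eigenvalue, and the one after it *)

(** No nonzero constant row has the form [v *m A]: the entries of [v *m A] sum to 0, as the rows of
    [A] do, and 1 + n is invertible. Since the left kernel is made of constants, 0 has no Jordan
    chain of length 2. *)
Lemma char_poly_simple0 (R : fieldType) n (A : 'M[R]_(1 + n)) :
    (1 + n)%:R != 0 :> R ->
    (forall j, \sum_i A i j = 0) -> (forall i, \sum_j A i j = 0) ->
    (forall v : 'rV_(1 + n), v *m A = 0 -> exists t, v = const_mx t) ->
  exists2 q, char_poly A = 'X * q & ~~ root q 0.
Proof.
move=> nN0 col0 row0 kerA.
(* Conjugating by P replaces the first row by the sum of the rows, which is 0. *)
pose u : 'rV[R]_n := const_mx 1.
pose P : 'M[R]_(1 + n) := block_mx 1%:M u 0 1%:M.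
pose c := dlsubmx A; pose M' := drsubmx A - c *m u.
pose M : 'M[R]_(1 + n) := block_mx 0 0 c M'.
have PA : P *m A = M *m P.
  rewrite -[A]submxK /P /M !mulmx_block !mul1mx !mul0mx !mulmx0 !add0r !mulmx1.
  rewrite addr0 -/c [c *m u + _]addrC subrK.
  congr block_mx; apply/matrixP=> i j; rewrite !mxE.
    rewrite -[RHS](col0 (lshift n j)) big_split_ord /= big_ord1 !ord1; congr (_ + _).
    by apply: eq_bigr => k _; rewrite !mxE mul1r.
  rewrite -[RHS](col0 (rshift 1 j)) big_split_ord /= big_ord1 !ord1; congr (_ + _).
  by apply: eq_bigr => k _; rewrite !mxE mul1r.
have charM : char_poly M = 'X * char_poly M'.
  rewrite /char_poly /char_poly_mx map_block_mx scalar_mx_block opp_block_mx.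
  by rewrite add_block_mx !map_mx0 !subr0 det_lblock det_scalar1.
exists (char_poly M').
  rewrite -charM /char_poly.
  have detP : \det (map_mx polyC P) = 1.
    by rewrite det_map_mx det_ublock !det1 mulr1.
  rewrite -[LHS]mul1r -[RHS]mulr1 -detP -!det_mulmx /char_poly_mx.
  by rewrite mulmxBr mulmxBl -!map_mxM PA scalar_mxC.
rewrite -eigenvalue_root_char; apply/negP => /eigenvalueP[v vM' /negP[]].
(* As [v *m M' = 0], all entries of [w *m A] equal [v *m c]. They sum to 0, so [w] is in the kernel;
   it is then constant with first entry 0. *)
pose w : 'rV[R]_(1 + n) := row_mx 0 v.
have wA : w *m A = const_mx ((v *m c) 0 0).
  rewrite -[A]submxK mul_row_block !mul0mx !add0r -/c.
  have -> : v *m drsubmx A = v *m c *m u.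
    by apply/eqP; rewrite -subr_eq0 -mulmxA -mulmxBr vM' scale0r.
  rewrite -[RHS]hsubmxK; congr row_mx; apply/matrixP=> i j; rewrite !mxE !ord1 ?mxE //.
  by rewrite big_ord1 !mxE mulr1.
have : \sum_j (w *m A) 0 j = 0.
  under eq_bigr => j _ do rewrite mxE.
  rewrite exchange_big big1 //= => i _.
  by rewrite -mulr_sumr row0 mulr0.
rewrite wA; under eq_bigr => j _ do rewrite mxE.
rewrite sumr_const card_ord -mulr_natr => /eqP; rewrite mulf_eq0 (negPf nN0) orbF => /eqP t0.
have [s ws] : exists s, w = const_mx s by apply: kerA; rewrite wA t0; apply/matrixP=> i j; rewrite !mxE.
have s0 : s = 0.
  by move/matrixP/(_ 0 (lshift n 0)): ws; rewrite row_mxEl !mxE.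
apply/eqP/matrixP => i j; rewrite ord1.
by move/matrixP/(_ 0 (rshift 1 j)): ws; rewrite row_mxEr !mxE s0.
Qed.

(** The root 0 is simple and the only one below [b], so the sorted list starts with 0, [b]. If [b]
    is a multiple root, its other copies lie in [l], with the remaining roots. *)
Lemma second_eigenvalue {R : rcfType} {n} {A : 'M[R]_n} {q : {poly R}} {b : R} :
    0 < b -> char_poly A = 'X * q -> ~~ root q 0 -> root (char_poly A) b ->
    (forall x, root (char_poly A) x -> x < b -> x = 0) ->
  nth 0 (eigenvalues A) 1 = b.
Proof.
move=> b_gt0 Aq q0 rootb root_lt; rewrite /eigenvalues.
set p := char_poly A in Aq rootb root_lt *.
have p_neq0 : p != 0 by rewrite monic_neq0 // char_poly_monic.
have memR x : (x \in rootsR p) = root p x.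
  by have /(_ x) := roots_on_rootsR p_neq0; rewrite in_itv.
have mup0 : mup 0 p = 1%N.
  rewrite Aq mupMl //; have := mup_XsubCX 1 (0 : R) 0.
  by rewrite eqxx subr0 expr1.
have /prednK mupb : (0 < mup b p)%N by rewrite -XsubC_dvd // dvdp_XsubCl.
have perm_roots : perm_eq (rootsR p) (0 :: b :: rem b (rem 0 (rootsR p))).
  have /perm_to_rem/permPl-> : 0 \in rootsR p.
    by rewrite memR Aq rootM rootX eqxx.
  rewrite perm_cons perm_to_rem // mem_rem_uniq ?uniq_roots //.
  by rewrite inE (gt_eqF b_gt0) memR.
set rs := rem b _ in perm_roots.
pose l := nseq (mup b p).-1 b ++ flatten [seq nseq (mup x p) x | x <- rs].
have /perm_sort_leP-> :
    perm_eq (flatten [seq nseq (mup x p) x | x <- rootsR p]) (0 :: b :: l).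
  apply: perm_trans (perm_flatten (perm_map _ perm_roots)) _.
  by rewrite /= mup0 -mupb.
suff b_min : all (>= b) l.
  have -> : sort <=%R [:: 0, b & l] = [:: 0, b & sort <=%R l] => //.
  rewrite -[RHS]sort_le_id; first by apply/perm_sort_leP; rewrite !perm_cons perm_sym perm_sort.
  rewrite /= ltW //= path_min_sorted ?sort_le_sorted //.
  by rewrite all_sort.
rewrite all_cat; apply/andP; split; first by rewrite all_nseq lexx orbT.
apply/allP => y /flatten_mapP[x xrs]; rewrite mem_nseq => /andP[_ /eqP->].
rewrite /= leNgt; apply/negP => x_lt.
have /root_lt/(_ x_lt) x0 : root p x by rewrite -memR (perm_mem perm_roots) !inE xrs !orbT.
have : uniq (0 :: b :: rs) by rewrite -(perm_uniq perm_roots) uniq_roots.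
by rewrite /= -x0 inE xrs orbT.
Qed.

(** * The Laplacian as an operator on functions *)

Definition laplacian_op {R : rcfType} {G : sgraph} (f : G -> R) (x : G) : R :=
  \sum_(y | adj x y) (f x - f y).

Lemma mul_laplacian_mx {R : rcfType} {G : sgraph} (v : 'rV[R]_#|G|) (x : G) :
  (v *m laplacian_mx R G) 0 (enum_rank x) =
    laplacian_op (fun y => v 0 (enum_rank y)) x.
Proof.
rewrite /laplacian_mx /degree_mx mulmxBr mul_mx_diag !mxE /laplacian_op.
rewrite sumrB enum_rankK; congr (_ - _).
  by rewrite sumr_const /degree mulr_natr.
rewrite (reindex _ (onW_bij _ (enum_rank_bij G))) /= [RHS]big_mkcond /=.
apply: eq_bigr => y _; rewrite mxE !enum_rankK adj_sym.
by case: (adj x y); rewrite ?mulr1 ?mulr0.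
Qed.

Lemma trmx_laplacian {R : rcfType} (G : sgraph) :
  (laplacian_mx R G)^T = laplacian_mx R G.
Proof.
rewrite /laplacian_mx linearB /= tr_diag_mx; congr (_ - _).
by apply/matrixP => i j; rewrite !mxE adj_sym.
Qed.

Lemma eigenvalue_laplacian {R : rcfType} {G : sgraph} {a : R} :
  root (char_poly (laplacian_mx R G)) a <->
    exists2 f : G -> R, forall x, laplacian_op f x = a * f x & exists x, f x != 0.
Proof.
rewrite -eigenvalue_root_char; split=> [/eigenvalueP[v va v_neq0] | [f fa [x fx]]].
  exists (fun x => v 0 (enum_rank x)) => [x|].
    by rewrite -mul_laplacian_mx va mxE.
  have /rV0Pn[i vi] := v_neq0.
  by exists (enum_val i); rewrite enum_valK.
apply/eigenvalueP; exists (\row_i f (enum_val i)); last first.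
  by apply/rV0Pn; exists (enum_rank x); rewrite mxE enum_rankK.
apply/rowP => i; rewrite -[i]enum_valK mul_laplacian_mx !mxE enum_rankK -fa.
rewrite /laplacian_op; apply: eq_bigr => y _.
by rewrite !mxE !enum_rankK.
Qed.

(** The case [a = 0] of the last hypothesis says that the kernel is made of constants, so 0 is a
    simple root. The Laplacian kills constants, so no other [a < b] is an eigenvalue. *)
Lemma algebraic_connectivityE {R : rcfType} (G : sgraph) (b : R) :
    0 < b ->
    (exists2 f : G -> R, forall x, laplacian_op f x = b * f x & exists x, f x != 0) ->
    (forall (a : R) (f : G -> R), a < b -> (forall x, laplacian_op f x = a * f x) ->
       forall x y, f x = f y) ->
  algebraic_connectivity R G = b.
Proof.
move=> b_gt0 fb const_lt.
(* Only the vertex is kept: it makes the size of the matrix positive. *)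
have [f _ [x0 _]] := fb.
have laplacian_row0 i : \sum_j laplacian_mx R G i j = 0.
  have := mul_laplacian_mx (const_mx 1 : 'rV[R]_#|G|) (enum_val i).
  rewrite enum_valK /laplacian_op [RHS]big1 => [|y _]; last by rewrite !mxE subrr.
  rewrite mxE => E; rewrite -[RHS]E; apply: eq_bigr => j _.
  by rewrite -[in LHS]trmx_laplacian [LHS]mxE [const_mx _ _ _]mxE mul1r.
have ker_const (v : 'rV[R]_#|G|) : v *m laplacian_mx R G = 0 -> exists t, v = const_mx t.
  move=> v0; exists (v 0 (enum_rank x0)); apply/rowP => i; rewrite mxE -[i]enum_valK.
  apply: (const_lt 0 (fun x => v 0 (enum_rank x))) => // x.
  by rewrite mul0r -mul_laplacian_mx v0 mxE.
have [q Lq q0] : exists2 q, char_poly (laplacian_mx R G) = 'X * q & ~~ root q 0.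
  have laplacian_col0 j : \sum_i laplacian_mx R G i j = 0.
    by under eq_bigr => i _ do rewrite -trmx_laplacian [_^T _ _]mxE.
  have : (0 < #|G|)%N by apply/card_gt0P; exists x0.
  move: (laplacian_mx R G) laplacian_row0 laplacian_col0 ker_const.
  case: #|G| => // n L *; apply: (@char_poly_simple0 R n L) => //.
  by rewrite pnatr_eq0.
apply: (second_eigenvalue b_gt0 Lq q0); first exact/eigenvalue_laplacian.
move=> a /eigenvalue_laplacian[g ga [x gx]] /const_lt/(_ ga) g_const.
have : laplacian_op g x = 0.
  by apply: big1 => y _; rewrite (g_const x y) subrr.
by rewrite ga => /eqP; rewrite mulf_eq0 (negPf gx) orbF => /eqP.
Qed.

(** * Kronecker product with a complete graph *)

(** Over each neighbour [q] of [p], all [(q, l)] but [(q, k)] are adjacent to [(p, k)]. The complete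
    graph has [m.+1] vertices, so [m] is the m - 1 of the theorem. *)
Lemma laplacian_op_kronecker_complete {R : rcfType} {H : sgraph} {m : nat}
    (f : kronecker H (complete m.+1) -> R) (p : H) (k : 'I_m.+1) :
  laplacian_op f (p, k) =
    \sum_(q | adj p q) (m%:R * f (p, k) - \sum_l f (q, l) + f (q, k)).
Proof.
rewrite /laplacian_op; transitivity (\sum_(q | adj p q) \sum_(l | k != l) (f (p, k) - f (q, l))).
  by rewrite pair_big; apply: eq_bigr => -[].
apply: eq_bigr => q _; rewrite (eq_bigl (predC1 k)) => [|l]; last by rewrite inE eq_sym.
rewrite sumrB sumr_const cardC1 card_ord -[f (p, k) *+ _]mulr_natl.
by rewrite [\sum_l f (q, l)](bigD1 k) //=; ring.
Qed.

Lemma laplacian_op_lift {R : rcfType} {H : sgraph} {m : nat} (F : H -> R)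
    (x : kronecker H (complete m.+1)) :
  laplacian_op (G := kronecker H (complete m.+1)) (fun x => F x.1) x =
    m%:R * laplacian_op F x.1.
Proof.
case: x => p k; rewrite laplacian_op_kronecker_complete /= mulr_sumr.
apply: eq_bigr => q _; rewrite sumr_const card_ord -[F q *+ _]mulr_natr -natr1; ring.
Qed.

(** In the difference of the layers [k] and [l] of [f], the sum over the complete graph cancels,
    which leaves the equation of m D + A. So the layers agree, and [f] is lifted from a function on
    [H]. *)
Lemma kronecker_complete_const {R : rcfType} {H : sgraph} {m : nat} (a : R) :
    (forall F : H -> R, (forall p, m%:R * laplacian_op F p = a * F p) ->
       forall p q, F p = F q) ->
    (forall F : H -> R,
       (forall p, \sum_(q | adj p q) (m%:R * F p + F q) = a * F p) ->
       forall p, F p = 0) ->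
  forall f : kronecker H (complete m.+1) -> R,
    (forall x, laplacian_op f x = a * f x) -> forall x y, f x = f y.
Proof.
move=> sym_const asym0 f fa.
have f_proj p k l : f (p, k) = f (p, l).
  apply/eqP; rewrite -subr_eq0; apply/eqP.
  apply: (asym0 (fun p => f (p, k) - f (p, l))) => {}p /=.
  rewrite [RHS]mulrBr -!fa !laplacian_op_kronecker_complete -sumrB.
  by apply: eq_bigr => q _; ring.
suff f0 p q : f (p, ord0) = f (q, ord0).
  by move=> [p k] [q l]; rewrite (f_proj p k ord0) (f_proj q l ord0).
apply: (sym_const (fun p => f (p, ord0))) => {}p.
rewrite -(laplacian_op_lift _ (p, ord0)) -fa; apply: eq_bigr => -[r l] _ /=.
by rewrite (f_proj r l ord0).
Qed.

(** * Eigenvalue equations on W', with mu = n + 2: each copy has one hub and n + 1 leaves *)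

Lemma sum_adj_Wprime {R : rcfType} {eta mu : nat} (F : Wprime eta mu -> R) i j :
  \sum_(q | adj (s := Wprime eta mu) (i, j) q) F q =
    \sum_k \sum_l if Wprime_adj (i, j) (k, l) then F (k, l) else 0.
Proof. by rewrite pair_bigA big_mkcond; apply: eq_bigr => -[]. Qed.

Lemma sum_adj_Wprime_hub {R : rcfType} {eta n : nat} (F : Wprime eta n.+1 -> R) i :
  \sum_(q | adj (s := Wprime eta n.+1) (i, ord0) q) F q =
    \sum_j F (i, lift ord0 j) + \sum_(k | k != i) F (k, ord0).
Proof.
rewrite sum_adj_Wprime (bigD1 i) //= big_ord_recl /Wprime_adj /= /complete_adj eqxx /= add0r.
congr (_ + _).
apply: eq_bigr => k ki; rewrite eq_sym in ki; rewrite big_ord_recl /= ki (negPf ki) /=.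
by rewrite big1 ?addr0.
Qed.

Lemma sum_adj_Wprime_leaf {R : rcfType} {eta n : nat} (F : Wprime eta n.+1 -> R) i l :
  \sum_(q | adj (s := Wprime eta n.+1) (i, lift ord0 l) q) F q =
    F (i, ord0) + \sum_(j | j != l) F (i, lift ord0 j).
Proof.
rewrite sum_adj_Wprime (bigD1 i) //= [X in _ + X]big1 => [|k ki]; last first.
  rewrite big1 // => j _.
  by rewrite /Wprime_adj /= /complete_adj eq_sym (negPf ki) andbF.
rewrite addr0 big_ord_recl /Wprime_adj /= /complete_adj eqxx /=; congr (_ + _).
rewrite [RHS]big_mkcond; apply: eq_bigr => j _.
by rewrite orbF (inj_eq lift_inj) eq_sym.
Qed.

(* [a = 1, s = -1] is the Laplacian and [a = m - 1, s = 1] the operator        *)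
(* (m - 1) D + A.                                                              *)
Lemma Wprime_reduce {R : rcfType} {eta n : nat} {a s x : R} {F : Wprime eta n.+2 -> R} :
    a * n.+1%:R - x - s != 0 ->
    (forall p, \sum_(q | adj p q) (a * F p + s * F q) = x * F p) ->
  exists2 w : 'I_eta -> R, forall i l, F (i, lift ord0 l) = w i &
    forall i, (a * n.+1%:R - x + s * n%:R) * w i = - s * F (i, ord0) /\
      (a * (n.+1%:R + eta%:R - 1) - x - s) * F (i, ord0) + s * n.+1%:R * w i
        + s * \sum_k F (k, ord0) = 0.
Proof.
move=> c_neq0 Fx.
pose S i := \sum_l F (i, lift ord0 l).
(* The right-hand side does not depend on the leaf, so the leaves of a copy share one value. *)
have leaf i l : (a * n.+1%:R - x - s) * F (i, lift ord0 l) = - s * (S i + F (i, ord0)).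
  have := Fx (i, lift ord0 l); rewrite sum_adj_Wprime_leaf big_split /=.
  rewrite sumr_const cardC1 card_ord /= -mulr_sumr -[a * _ *+ _]mulr_natr.
  have -> : S i = F (i, lift ord0 l) + \sum_(j | j != l) F (i, lift ord0 j).
    by rewrite /S (bigD1 l).
  by rewrite -natr1; lra.
have leafE i l : F (i, lift ord0 l) = F (i, lift ord0 ord0).
  by apply: (mulfI c_neq0); rewrite !leaf.
exists (fun i => F (i, lift ord0 ord0)) => // i.
have SE : S i = n.+1%:R * F (i, lift ord0 ord0).
  rewrite /S (eq_bigr _ (fun l _ => leafE i l)).
  by rewrite sumr_const card_ord mulr_natl.
split.
  by have := leaf i ord0; rewrite SE -natr1; lra.
have := Fx (i, ord0); rewrite sum_adj_Wprime_hub !big_split /=.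
rewrite !sumr_const cardC1 !card_ord -!mulr_sumr -!(mulr_natr (a * _)) -/(S i) SE.
rewrite [\sum_k F (k, ord0)](bigD1 i) //=.
have -> : eta%:R = eta.-1%:R + 1 :> R by rewrite natr1 prednK // (leq_ltn_trans _ (ltn_ord i)).
by lra.
Qed.

Lemma Wprime_laplacian_const {R : rcfType} {eta n : nat} {alpha y : R}
    {F : Wprime eta n.+2 -> R} :
    0 < alpha -> alpha < 1 -> y < alpha ->
    alpha ^+ 2 - (n.+2%:R + eta%:R) * alpha + eta%:R = 0 ->
    (forall p, laplacian_op F p = y * F p) ->
  forall p q, F p = F q.
Proof.
move=> alpha_gt0 alpha_lt1 y_lt; rewrite -(natr1 n.+1) => alpha_root Fy.
have n_ge1 : 1 <= n.+1%:R :> R by rewrite ler1n.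
have eta_ge0 : 0 <= eta%:R :> R := ler0n _ _.
have yF p : \sum_(q | adj p q) (1 * F p + -1 * F q) = y * F p.
  by rewrite -Fy; apply: eq_bigr => q _; rewrite mul1r mulN1r.
have [|w Fw wE] := Wprime_reduce _ yF; first by apply: lt0r_neq0; lra.
have hubE i : F (i, ord0) = (1 - y) * w i.
  by have [+ _] := wE i; rewrite -natr1; lra.
pose W := \sum_k F (k, ord0).
have wW i : (y ^+ 2 - (n.+1%:R + 1 + eta%:R) * y + eta%:R) * w i = W.
  by have [_] := wE i; rewrite hubE -/W; lra.
(* The roots of this quadratic are [alpha] and mu + eta - alpha, and [y] lies below both. *)
have q_neq0 : y ^+ 2 - (n.+1%:R + 1 + eta%:R) * y + eta%:R != 0.
  have -> : y ^+ 2 - (n.+1%:R + 1 + eta%:R) * y + eta%:R =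
      (alpha - y) * (n.+1%:R + 1 + eta%:R - alpha - y) by lra.
  by apply: lt0r_neq0; apply: mulr_gt0; lra.
have w_const i j : w i = w j by apply: (mulfI q_neq0); rewrite !wW.
(* For constant [w], [wW] collapses to y (y - mu) w = 0, and y < 1 < mu. By [hubE], hubs and leaves
   then agree. *)
have yw0 i : y * w i = 0.
  have WE : W = eta%:R * ((1 - y) * w i).
    rewrite /W (eq_bigr (fun=> (1 - y) * w i)) => [|k _].
      by rewrite sumr_const card_ord mulr_natl.
    by rewrite hubE (w_const k i).
  have /eqP : (y - (n.+1%:R + 1)) * (y * w i) = 0 by have := wW i; rewrite WE; lra.
  by rewrite mulf_eq0 lt_eqF /= => [/eqP|]; last lra.
have FE i j : F (i, j) = w i.
  case: (unliftP ord0 j) => [l ->|->]; first exact: Fw.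
  by rewrite hubE mulrBl yw0 mul1r subr0.
by move=> [i j] [k l]; rewrite !FE.
Qed.

(** For [x < a] the coefficients met in the elimination are positive. Summing the hub equations
    gives [W = 0], and then the hubs and the leaves vanish in turn. *)
Lemma Wprime_signless_eq0 {R : rcfType} {eta n : nat} {a x : R}
    {F : Wprime eta n.+2 -> R} :
    (1 <= n)%N -> (3 <= eta)%N -> 1 <= a -> x < a ->
    (forall p, \sum_(q | adj p q) (a * F p + F q) = x * F p) ->
  forall p, F p = 0.
Proof.
move=> n_ge1 eta_ge3 a_ge1 x_lt Fx.
have n_ge2 : 2 <= n.+1%:R :> R by rewrite ler_nat.
have {}eta_ge3 : 3 <= eta%:R :> R by rewrite ler_nat.
have c_gt0 : 0 < a * n.+1%:R - x - 1 by nra.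
have xF p : \sum_(q | adj p q) (a * F p + 1 * F q) = x * F p.
  by rewrite -Fx; apply: eq_bigr => q _; rewrite mul1r.
have [|w Fw wE] := Wprime_reduce _ xF; first exact: lt0r_neq0.
pose W := \sum_k F (k, ord0).
pose t := a * n.+1%:R - x - 1 + n.+1%:R.
pose B := a * (n.+1%:R + eta%:R - 1) - x - 1.
have t_gt : n.+1%:R < t by rewrite /t; lra.
have B_gt1 : 1 < B by rewrite /B; nra.
have leafE i : t * w i = - F (i, ord0).
  by have [+ _] := wE i; rewrite /t -natr1; lra.
have hubW i : (B * t - n.+1%:R) * F (i, ord0) = - (t * W).
  have [_] := wE i; rewrite -/W !mul1r => E.
  have {}E : t * (B * F (i, ord0) + n.+1%:R * w i + W) = 0 by rewrite E mulr0.
  by have := leafE i; nra.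
have D_gt0 : 0 < B * t - n.+1%:R by nra.
have W0 : W = 0.
  have : (B * t - n.+1%:R) * W = - (eta%:R * (t * W)).
    rewrite /W mulr_sumr (eq_bigr _ (fun k _ => hubW k)) sumr_const card_ord.
    by rewrite mulNrn mulr_natl.
  have /lt0r_neq0 D'_neq0 : 0 < B * t - n.+1%:R + eta%:R * t by nra.
  by move=> WE; apply: (mulfI D'_neq0); lra.
have hub0 i : F (i, ord0) = 0.
  have /eqP := hubW i; rewrite W0 mulr0 oppr0 mulf_eq0 gt_eqF //=.
  by move/eqP.
have w0 i : w i = 0.
  have /eqP := leafE i; rewrite hub0 oppr0 mulf_eq0 gt_eqF /=; last lra.
  by move/eqP.
move=> [i j]; case: (unliftP ord0 j) => [l ->|->]; last exact: hub0.
by rewrite Fw.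
Qed.

(** The vector [w], of sum 0 on K_eta, is placed on the leaves. The leaf equation forces
    [(1 - alpha) * w] on the hubs, and the hub equation becomes the quadratic for [alpha]. *)
Lemma Wprime_laplacian_eigenvector {R : rcfType} {eta n : nat} {alpha : R} :
    (2 <= eta)%N ->
    alpha ^+ 2 - (n.+2%:R + eta%:R) * alpha + eta%:R = 0 ->
  exists2 F : Wprime eta n.+2 -> R,
    forall p, laplacian_op F p = alpha * F p & exists p, F p != 0.
Proof.
case: eta => [|[|eta]] // _ alpha_root.
pose w (i : 'I_eta.+2) : R := (i == ord0)%:R - (i == lift ord0 ord0)%:R.
have sum_w : \sum_i w i = 0.
  rewrite /w big_ord_recl big_ord_recl big1 => [|k _]; last by rewrite subrr.
  by rewrite /= addr0 subr0 sub0r subrr.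
pose F (p : Wprime eta.+2 n.+2) := (if p.2 == ord0 then 1 - alpha else 1) * w p.1.
exists F; last first.
  (* At this leaf the value is 1; at a hub it would carry the factor [1 - alpha]. *)
  by exists (ord0, lift ord0 ord0); rewrite /F /w /= subr0 mulr1 oner_neq0.
move=> [i j]; rewrite /laplacian_op.
case: (unliftP ord0 j) => [l ->|->].
  rewrite sum_adj_Wprime_leaf big1 => [|k _]; last by rewrite subrr.
  by rewrite /F /=; ring.
rewrite sum_adj_Wprime_hub /F /= sumr_const card_ord -[_ *+ n.+1]mulr_natr.
transitivity (- alpha * n.+1%:R * w i + (1 - alpha) * \sum_k (w i - w k)).
  rewrite [\sum_k _](bigD1 i) //= subrr add0r mulr_sumr; congr (_ + _); first by ring.
  by apply: eq_bigr => k _; rewrite [RHS]mulrBr.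
rewrite sumrB sum_w subr0 sumr_const card_ord -[w i *+ _]mulr_natr.
apply/eqP; rewrite -subr_eq0; apply/eqP; rewrite -[RHS](mul0r (w i)) -alpha_root -(natr1 n.+1).
by ring.
Qed.

Theorem theorem12 (R : rcfType) (eta mu m : nat)
    (heta : (3 <= eta)%N) (hmu : (3 <= mu)%N) (hm : (2 <= m)%N) :
  algebraic_connectivity R (kronecker (Wprime eta mu) (complete m)) =
    (m%:R - 1) *
      ((mu%:R + eta%:R - Num.sqrt ((mu%:R + eta%:R) ^+ 2 - 4 * eta%:R)) / 2).
Proof.
case: mu hmu => [|[|n]] // n_gt0; case: m hm => [|m] // m_gt0.
have eta_ge3 : 3 <= eta%:R :> R by rewrite ler_nat.
have mu_ge3 : 3 <= n.+2%:R :> R by rewrite ler_nat.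
have m_ge1 : 1 <= m%:R :> R by rewrite ler1n.
set D := n.+2%:R + eta%:R; set r := Num.sqrt _; set alpha := (D - r) / 2.
have r_ge0 : 0 <= r := sqrtr_ge0 _.
have r2 : r ^+ 2 = D ^+ 2 - 4 * eta%:R by apply: sqr_sqrtr; rewrite /D; nra.
have r_ltD : r < D.
  rewrite -(ltr_pXn2r (n := 2)) ?nnegrE //; rewrite ?r2 /D; lra.
(* This is [alpha < 1]; squared, it reads eta + 1 < D. *)
have D_ltr : D - 2 < r.
  rewrite -(ltr_pXn2r (n := 2)) ?nnegrE //; rewrite ?r2 /D; lra.
have alpha_gt0 : 0 < alpha by rewrite /alpha; lra.
have alpha_lt1 : alpha < 1 by rewrite /alpha; lra.
have alpha_root : alpha ^+ 2 - D * alpha + eta%:R = 0.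
  have -> : alpha ^+ 2 - D * alpha + eta%:R = (r ^+ 2 - D ^+ 2 + 4 * eta%:R) / 4.
    by rewrite /alpha; field.
  by rewrite r2 -[RHS](mul0r 4^-1); ring.
rewrite -natr1 addrK; apply: algebraic_connectivityE.
- by apply: mulr_gt0 => //; lra.
- have [|F Falpha [p Fp]] := Wprime_laplacian_eigenvector _ alpha_root; first exact: ltnW.
  exists (fun x => F x.1) => [x|]; last by exists (p, ord0).
  by rewrite laplacian_op_lift Falpha mulrA.
move=> a f a_lt; apply: kronecker_complete_const => F Fa.
- have m_neq0 : m%:R != 0 :> R by apply: lt0r_neq0; lra.
  apply: (Wprime_laplacian_const (y := a / m%:R) alpha_gt0 alpha_lt1 _ alpha_root) => [|p].
    by rewrite ltr_pdivrMr 1?mulrC //; lra.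
  by apply: (mulfI m_neq0); rewrite Fa; field.
(* As [alpha < 1], the bound [a < m * alpha] gives [a < m]. *)
apply: (Wprime_signless_eq0 _ _ m_ge1 _ Fa) => //.
by apply: lt_trans a_lt _; nra.
Qed.
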